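(* There is a $16\,CS\to1\,\mathrm{TOF\#}$ distillation protocol at distance $3$. Precisely, let $G\in\mathbb F_4^{6\times16}$ have columns indexed by $(x,y)\in\mathbb F_4^2$ and rows the evaluations of $xy,\ x^2,\ y^2,\ x,\ y,\ 1$ in this order. Binarize $G$ to a $12\times32$ binary matrix (see context), and let $H\in\mathbb F_2^{11\times32}$ be obtained by deleting its first row (the first binary row coming from $xy$). Let the first five rows of $H$ be logical rows and the last six be stabilizer rows. Then $H$ has full rank; the unitary $D_H$ induced by applying $CS$ to each of the 16 pairs of adjacent physical qubits satisfies $D_H=C\,(V\otimes I)$ for some diagonal Clifford unitary $C$ on $11$ qubits and some unitary $V$ on the five logical qubits that is Clifford equivalent to $\mathrm{TOF\#}$; and the block $Z$-distance of $H$ (with respect to the 16 pairs) is $3$.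
   Context: $\mathbb F_4=\{0,1,\omega,\omega^2\}$, $\omega^2=\omega+1$, $\mathrm{tr}(\gamma)=\gamma+\gamma^2\in\mathbb F_2$. Binarization (self-dual basis $\{\omega,\omega^2\}$) replaces each entry $\gamma$ of an $\mathbb F_4$-matrix by the $2\times2$ binary block $\begin{pmatrix}\mathrm{tr}(\gamma\omega^2)&\mathrm{tr}(\gamma)\\\mathrm{tr}(\gamma)&\mathrm{tr}(\gamma\omega)\end{pmatrix}$. For a binary matrix $H\in\mathbb F_2^{m\times2n}$ with rows $\mathbf h_1,\dots,\mathbf h_m$, columns grouped into $n$ adjacent pairs, the unitary on $m$ qubits induced by applying $CS$ (phase $i^{ab}$ on $|a\rangle|b\rangle$) to each pair is $D_H|z\rangle=i^{\sum_{j=1}^nw_{2j-1}w_{2j}}|z\rangle$ where $w=\sum_az_a\mathbf h_a\bmod2\in\{0,1\}^{2n}$. With logical and stabilizer rows specified, the block $Z$-distance is the minimum, over vectors $e\in\mathbb F_2^{2n}$ orthogonal to all stabilizer rows but not to at least one logical row, of the number of pairs on which $e$ is nonzero. $\mathrm{TOF\#}$ is the five-qubit gate $|z\rangle\mapsto(-1)^{z_1z_2z_3+z_3z_4z_5}|z\rangle$. Unitaries $U,V$ are Clifford equivalent if $U=C_1VC_2$ for Clifford unitaries $C_1,C_2$. *)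

(* Defs.v *)
From HB Require Import structures.
From mathcomp Require Import all_boot all_order all_algebra all_field.
From mathcomp Require Import reals complex.

Set Implicit Arguments.
Unset Strict Implicit.
Unset Printing Implicit Defensive.

Import Order.TTheory GRing.Theory Num.Theory.
Local Open Scope ring_scope.
Local Open Scope sesquilinear_scope.

(* Indices are 0-based: the adjacent pair j consists of indices 2j and 2j+1. *)

Fact even_idx_subproof n (j : 'I_n) : (j.*2 < n.*2)%N.
Proof. by rewrite ltn_double. Qed.
Definition even_idx n (j : 'I_n) : 'I_(n.*2) := Ordinal (even_idx_subproof j).

Fact odd_idx_subproof n (j : 'I_n) : (j.*2.+1 < n.*2)%N.
Proof. by rewrite ltn_Sdouble. Qed.
Definition odd_idx n (j : 'I_n) : 'I_(n.*2) := Ordinal (odd_idx_subproof j).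

Fact pair_idx_subproof n (r : 'I_(n.*2)) : (r./2 < n)%N.
Proof. by rewrite ltn_half_double. Qed.
Definition pair_idx n (r : 'I_(n.*2)) : 'I_n := Ordinal (pair_idx_subproof r).

Section Binarization.
Variables (F : finFieldType) (w : F).

(* In a field with four elements g + g^2 is 0 or 1; trF4 g is that element
   read in 'F_2, as trF4E shows. *)
Definition trF4 (g : F) : 'F_2 := (g + g ^+ 2 != 0)%:R.

Lemma trF4E (g : F) : #|F| = 4%N -> g + g ^+ 2 = (trF4 g : nat)%:R.
Proof.
move=> F4; have g4 : g ^+ 4 = g by rewrite -F4 expf_card.
have ch2 : 2%N \in [pchar F].
  exact: (@card_finPcharP _ 2 2 F4 isT).
have tt : (g + g ^+ 2) * (g + g ^+ 2) = (g + g ^+ 2) * 1.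
  rewrite mulr1 -expr2 sqrrD -exprM g4 -exprS mulr2n.
  by rewrite addrr_pchar2 // addr0 addrC.
rewrite /trF4; have [-> // | nz] := eqVneq (g + g ^+ 2) 0.
exact: (mulfI nz tt).
Qed.

Definition bin_block (g : F) (odd_row odd_col : bool) : 'F_2 :=
  match odd_row, odd_col with
  | false, false => trF4 (g * w ^+ 2)
  | true, true => trF4 (g * w)
  | _, _ => trF4 g
  end.

Definition binarize m n (G : 'M[F]_(m, n)) : 'M['F_2]_(m.*2, n.*2) :=
  \matrix_(r, c) bin_block (G (pair_idx r) (pair_idx c)) (odd r) (odd c).

(* col enumerates the points (x, y) of the affine plane in column order. *)
Definition evalG (col : 'I_16 -> F * F) : 'M[F]_(6, 16) :=
  \matrix_(r, c) let: (x, y) := col c in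
    [:: x * y; x ^+ 2; y ^+ 2; x; y; 1]`_r.

Definition tofH (col : 'I_16 -> F * F) : 'M['F_2]_(5 + 6, 16.*2) :=
  row' ord0 (binarize (evalG col)).

End Binarization.

Section BlockDistance.
Variables k s n : nat.

Definition pair_weight (e : 'rV['F_2]_(n.*2)) : nat :=
  #|[set j : 'I_n | (e 0 (even_idx j) != 0) || (e 0 (odd_idx j) != 0)]|.

(* The first k rows of H are logical, the last s are stabilizer rows. *)
Definition logical_Z_error (H : 'M['F_2]_(k + s, n.*2)) (e : 'rV['F_2]_(n.*2)) :=
  (forall i : 'I_s, \sum_c e 0 c * dsubmx H i c = 0) /\
  (exists i : 'I_k, \sum_c e 0 c * usubmx H i c != 0).

Definition is_block_Z_distance (H : 'M['F_2]_(k + s, n.*2)) (d : nat) :=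
  (exists e, logical_Z_error H e /\ pair_weight e = d) /\
  (forall e, logical_Z_error H e -> (d <= pair_weight e)%N).

End BlockDistance.

(* The computational basis of m qubits is indexed by the bit vectors z in F_2^m;
   operators are matrices over an enumeration of these vectors.  Matrices act
   on column vectors, so entry (x, z) is the amplitude <x| U |z>. *)
Notation bits m := ('rV['F_2]_m).
Definition bit m (z : bits m) (i : 'I_m) : nat := z 0 i.
Notation qop C m := ('M[C]_#|{: bits m}|).

Section Operators.
Variable C : numClosedFieldType.

Definition op_of m (f : bits m -> bits m -> C) : qop C m :=
  \matrix_(i, j) f (enum_val i) (enum_val j).

Definition entry m (U : qop C m) (x z : bits m) : C :=
  U (enum_rank x) (enum_rank z).

Definition diag_op m (f : bits m -> C) : qop C m :=
  op_of (fun x z => if x == z then f z else 0).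

Definition op_tensor k s (U : qop C k) (W : qop C s) : qop C (k + s) :=
  op_of (fun x z => entry U (lsubmx x) (lsubmx z) *
                    entry W (rsubmx x) (rsubmx z)).

(* i^t X(a) Z(b), that is |z> |-> i^t (-1)^(b.z) |z + a>. *)
Definition pauli_op m (t : nat) (a b : bits m) : qop C m :=
  op_of (fun x z => if x == z + a
                    then 'i ^+ t * (-1) ^+ (\sum_j bit b j * bit z j)%N
                    else 0).

Definition is_pauli m (P : qop C m) := exists t a b, P = pauli_op t a b.

(* The unitary normalizer of the Pauli group.  The Pauli group is finite, so
   mapping it into itself by conjugation is the same as normalizing it. *)
Definition is_clifford m (U : qop C m) :=
  U \is unitarymx /\
  (forall P : qop C m, is_pauli P -> is_pauli (U *m P *m U^t*)).

Definition clifford_equiv m (U V : qop C m) :=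
  exists C1 C2 : qop C m,
    [/\ is_clifford C1, is_clifford C2 & U = C1 *m V *m C2].

(* The exponent is an integer sum of products of bits, not reduced mod 2; only
   the combination z *m H of the rows is. *)
Definition CS_op m n (H : 'M['F_2]_(m, n.*2)) : qop C m :=
  diag_op (fun z => let w := z *m H in
    'i ^+ (\sum_(j < n) bit w (even_idx j) * bit w (odd_idx j))%N).

Definition TOFsharp : qop C 5 :=
  diag_op (fun z => let b (i : nat) : nat := bit z (inord i) in
    (-1) ^+ (b 0 * b 1 * b 2 + b 2 * b 3 * b 4)%N).

End Operators.
Arguments TOFsharp C : clear implicits.
Arguments CS_op C {m n} H.

(* Main.v *)
(* Reading a pair of physical bits as the coordinates of an element of F_4 in
   the basis {w, w^2}, the codeword of z is the list of values f_z(x, y) of the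
   polynomial f_z = a xy + b x^2 + c y^2 + d x + e y + g with coefficients given
   by z, and both bits of a pair are 1 exactly where f_z = w + w^2 = 1.  Hence
   D_H |z> = i^N(z) |z> with N(z) the number of points of the plane where
   f_z = 1.  Enumerating the 2^11 inputs gives
     N(z) = 3 z_0 + 2 z_0 (z_1 z_3 + z_1 z_4 + z_2 z_3)  mod 4,
   which involves only logical bits: a phase gate on qubit 0 times the conjugate
   of TOF# by an invertible linear map of F_2^5.
   An error e is orthogonal to the stabilizer rows iff its F_4 values E satisfy
   sum E = sum E x = sum E y = 0; two points cannot support such an E <> 0, and
   three points on an affine line can, with sum E x^2 <> 0. *)

Require Import Defs.
From HB Require Import structures.
From mathcomp Require Import all_boot all_order all_algebra all_field.
From mathcomp Require Import reals complex.
From mathcomp Require Import zify.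

Set Implicit Arguments.
Unset Strict Implicit.
Unset Printing Implicit Defensive.

Import Order.TTheory GRing.Theory Num.Theory.
Local Open Scope ring_scope.

(** * Monomial operators on qubits and the Clifford gates among them *)

Section MonomialOperators.
Variable C : numClosedFieldType.
Local Open Scope sesquilinear_scope.

(** Pauli, diagonal and linear basis-change operators all have this form, so their products and
    adjoints reduce to composing functions. *)
Definition mono_op m (f : bits m -> C) (p : bits m -> bits m) : qop C m :=
  op_of (fun x z => if x == p z then f z else 0).

Lemma eq_op_of m (f g : bits m -> bits m -> C) : f =2 g -> op_of f = op_of g.
Proof. by move=> fg; apply/matrixP => i j; rewrite !mxE fg. Qed.

Lemma eq_mono_op m (f g : bits m -> C) p q :
  f =1 g -> p =1 q -> mono_op f p = mono_op g q.
Proof. by move=> fg pq; apply: eq_op_of => x z; rewrite fg pq. Qed.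

Lemma mono_op1 m : mono_op (fun=> 1) id = 1%:M :> qop C m.
Proof.
apply/matrixP => i j; rewrite !mxE (inj_eq enum_val_inj).
by case: eqP.
Qed.

Lemma mono_opM m (f g : bits m -> C) p q :
  mono_op g q *m mono_op f p = mono_op (fun z => g (p z) * f z) (q \o p).
Proof.
apply/matrixP => i j; rewrite !mxE (bigD1 (enum_rank (p (enum_val j)))) //=.
rewrite !mxE enum_rankK eqxx big1 => [|k ne].
  by rewrite addr0; case: ifP; rewrite ?mul0r.
rewrite !mxE; case: (enum_val k =P _) => [e|_]; last by rewrite mulr0.
by rewrite -e enum_valK eqxx in ne.
Qed.

Lemma mono_op_adj m (f : bits m -> C) p q : cancel p q -> cancel q p ->
  (mono_op f p)^t* = mono_op (fun z => (f (q z))^*) q.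
Proof.
move=> pK qK; apply/matrixP => i j; rewrite !mxE.
rewrite [_ == p _]eq_sym (can2_eq pK qK).
by case: eqP => [->|_] //; exact: rmorph0.
Qed.

Lemma pauli_opE m t (a b : bits m) : pauli_op C t a b =
  mono_op (fun z => 'i ^+ t * (-1) ^+ (\sum_j bit b j * bit z j)%N) (+%R^~ a).
Proof. by []. Qed.

Lemma diag_opE m (f : bits m -> C) : diag_op f = mono_op f id.
Proof. by []. Qed.

Lemma mono_op_unitary m (f : bits m -> C) p q : cancel p q -> cancel q p ->
  (forall z, f z * (f z)^* = 1) -> mono_op f p \is unitarymx.
Proof.
move=> pK qK f1; apply/unitarymxP.
rewrite (mono_op_adj _ pK qK) mono_opM -mono_op1.
by apply: eq_mono_op => z /=; rewrite ?f1 ?qK.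
Qed.

Lemma val_F2_nat n : (n%:R : 'F_2) = odd n :> nat.
Proof. by rewrite val_Fp_nat // modn2. Qed.

Lemma signF2 m (b z : bits m) :
  (-1) ^+ (\sum_j bit b j * bit z j)%N = (-1) ^+ ((b *m z^T) 0 0 : nat) :> C.
Proof.
have -> : (b *m z^T) 0 0 = (\sum_j bit b j * bit z j)%N%:R.
  by rewrite !mxE natr_sum; apply: eq_bigr => j _; rewrite mxE natrM !natr_Zp.
by rewrite val_F2_nat signr_odd.
Qed.

Lemma val_F2D (u v : 'F_2) : (u + v)%R = odd (u + v) :> nat.
Proof. by move: u v => [[|[|//]] ?] [[|[|//]] ?]. Qed.

Lemma signF2D (u v : 'F_2) :
  (-1) ^+ (u + v)%R = (-1) ^+ (u : nat) * (-1) ^+ (v : nat) :> C.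
Proof. by rewrite -exprD val_F2D signr_odd. Qed.

Definition linear_op m (A : 'M['F_2]_m) : qop C m :=
  mono_op (fun=> 1) (fun z => z *m A).

(** Conjugation sends [X(a) Z(b)] to [X(a A) Z(b A^-T)], because [b . (z A^-1) = (b A^-T) . z]. *)
Lemma linear_op_clifford m (A : 'M['F_2]_m) :
  A \in unitmx -> is_clifford (linear_op A).
Proof.
move=> uA; pose p (z : bits m) := z *m A; pose q (z : bits m) := z *m invmx A.
have pK : cancel p q by exact: mulmxK.
have qK : cancel q p by exact: mulmxKV.
rewrite /linear_op -/p; split.
  by apply: (mono_op_unitary pK qK) => z; rewrite conjC1 mulr1.
move=> _ [t [a [b ->]]]; exists t, (a *m A), (b *m (invmx A)^T).
rewrite !pauli_opE (mono_op_adj _ pK qK) !mono_opM.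
apply: eq_mono_op => z /=; last first.
  by rewrite [LHS]mulmxDl; congr (_ + _); exact: qK.
by rewrite conjC1 mul1r mulr1 !signF2 trmx_mul mulmxA.
Qed.

Lemma unit_phaseX (t : nat) : ('i : C) ^+ t * ('i ^+ t)^* = 1.
Proof. by rewrite rmorphXn /= -exprMn conjCi mulrN -expr2 sqrCi opprK expr1n. Qed.

Lemma imagCX2 (t : nat) : ('i : C) ^+ (2 * t) = (-1) ^+ t.
Proof. by rewrite exprM sqrCi. Qed.

Lemma imagCX_mod4 (t : nat) : ('i : C) ^+ (t %% 4) = 'i ^+ t.
Proof.
rewrite {2}(divn_eq t 4) exprD mulnC exprM (_ : 4 = 2 * 2)%N // imagCX2.
rewrite sqrrN expr1n.
by rewrite expr1n mul1r.
Qed.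

Definition phase_op m (c : nat) (k : 'I_m) : qop C m :=
  mono_op (fun z => 'i ^+ (c * bit z k)%N) id.

(** Moving the gate past [X(a)] leaves the ratio of [i^(c (z+a)_k)] to [i^(c z_k)], a constant times
    a sign linear in [z_k]; the constant goes into [t] and the sign into the [Z] part. *)
Lemma phase_op_clifford m c (k : 'I_m) : is_clifford (phase_op c k).
Proof.
split; first by apply: (@mono_op_unitary _ _ _ id) => // z; exact: unit_phaseX.
move=> _ [t [a [b ->]]].
exists (t + c * bit a k)%N, a, (b + (c * bit a k)%N%:R *: delta_mx 0 k).
rewrite !pauli_opE (mono_op_adj _ (q := id)) // !mono_opM.
apply: eq_mono_op => z //=; rewrite !signF2.
have -> : ((b + (c * bit a k)%N%:R *: delta_mx 0 k) *m z^T) 0 0 =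
          (b *m z^T) 0 0 + (c * bit a k * bit z k)%N%:R.
  by rewrite mulmxDl mxE -scalemxAl -rowE !mxE [in RHS]natrM natr_Zp.
rewrite signF2D val_F2_nat signr_odd exprD.
(* As integers, the bit of [z + a] is [a_k + z_k - 2 a_k z_k]; the last term produces the sign. *)
suff -> : 'i ^+ (c * bit (z + a) k) =
    'i ^+ (c * bit a k) * (-1) ^+ (c * bit a k * bit z k)
    * 'i ^+ (c * bit z k) :> C.
  set u := 'i ^+ (c * bit z k).
  rewrite [_ * u * _]mulrAC -[_ * u * _]mulrA unit_phaseX mulr1 mulrACA.
  by congr (_ * _); rewrite mulrC.
rewrite /bit mxE -imagCX2 -!exprD -[LHS]imagCX_mod4 -[RHS]imagCX_mod4.
congr (_ ^+ _).
rewrite val_F2D; case: (z 0 k) (a 0 k) => [[|[|//]] ?] [[|[|//]] ?] /=.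
all: rewrite !(muln0, muln1, addn0, add0n).
all: lia.
Qed.

Lemma mono_op_diag m (f : bits m -> C) : is_diag_mx (mono_op f id).
Proof.
apply/is_diag_mxP => i j ij; rewrite mxE; case: eqP => // /enum_val_inj e.
by rewrite e eqxx in ij.
Qed.

Lemma op_tensor_diag1 k s (f : bits k -> C) :
  op_tensor (mono_op f id) (1%:M : qop C s) =
  mono_op (fun z => f (lsubmx z)) id.
Proof.
rewrite -mono_op1; apply: eq_op_of => x z; rewrite /entry !mxE !enum_rankK.
have -> : (x == z) = (lsubmx x == lsubmx z) && (rsubmx x == rsubmx z).
  apply/eqP/andP => [-> //|[/eqP l /eqP r]].
  by rewrite -[x]hsubmxK -[z]hsubmxK l r.
by do 2!case: eqP => _; rewrite /= ?mulr1 ?mulr0 ?mul0r.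
Qed.

End MonomialOperators.

(** * A computable model of F_4 and exhaustive checks over it *)

Section BooleanF4.

(* [(a, b)] stands for [a w + b w^2]; the basis is self-dual, so [a] and [b]
   are also the traces of the products with [w] and [w^2]. *)
Definition f4 := (bool * bool)%type.

(** The cross terms carry [w^3 = 1 = w + w^2], hence [c] in both coordinates; [w w = w^2] and
    [w^2 w^2 = w] exchange the other two. *)
Definition f4_mul (p q : f4) : f4 :=
  let c := p.1 && q.2 (+) p.2 && q.1 in
  (p.2 && q.2 (+) c, p.1 && q.1 (+) c).

(** This is [tr(p q)], since the basis is self-dual. *)
Definition f4_dot (p q : f4) : bool := p.1 && q.1 (+) p.2 && q.2.

Definition f4_coord (b : bool) (p : f4) : bool := if b then p.2 else p.1.

Definition f4_elems : seq f4 :=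
  [:: (false, false); (false, true); (true, false); (true, true)].

Definition f4_plane : seq (f4 * f4) :=
  [seq (x, y) | x <- f4_elems, y <- f4_elems].

(* Row [r] of [tofH] is row [r + 1] of the binarized matrix. *)
Definition f4_row (r : nat) (p : f4 * f4) : f4 :=
  let: (x, y) := p in
  f4_mul (nth (false, false)
    [:: f4_mul x y; f4_mul x x; f4_mul y y; x; y; (true, true)] r.+1./2)
    (if odd r then (true, false) else (false, true)).

Definition f4_word (s : seq bool) (p : f4 * f4) (b : bool) : bool :=
  foldr addb false
    [seq nth false s r && f4_coord b (f4_row r p) | r <- iota 0 11].

Fixpoint bool_words (n : nat) : seq (seq bool) :=
  if n is n'.+1 then
    [seq false :: s | s <- bool_words n'] ++
    [seq true :: s | s <- bool_words n']
  else [:: [::]].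

Lemma mem_bool_words (s : seq bool) : s \in bool_words (size s).
Proof.
elim: s => [|[] s IHs] //=; rewrite mem_cat; apply/orP; [right|left];
  exact: map_f.
Qed.

Lemma mem_f4_plane (p : f4 * f4) : p \in f4_plane.
Proof. by move: p => [[[] []] [[] []]]. Qed.

Lemma big_f4_plane (T : Type) (idx : T) (op : Monoid.com_law idx)
    (P : pred (f4 * f4)) (g : f4 * f4 -> T) :
  \big[op/idx]_(p | P p) g p = \big[op/idx]_(p <- f4_plane | P p) g p.
Proof.
apply: perm_big; apply: uniq_perm; rewrite ?index_enum_uniq // => p.
by rewrite mem_index_enum mem_f4_plane.
Qed.

Definition tof_cubic (s : seq bool) : nat :=
  let b (i : nat) : nat := nth false s i in
  (b 0 * (b 1 * b 3 + b 1 * b 4 + b 2 * b 3))%N.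

Lemma f4_word_phase (s : seq bool) : size s = 11%N ->
  ((\sum_(p : f4 * f4) f4_word s p false * f4_word s p true)%N
   = 3 * nth false s 0 + 2 * tof_cubic s %[mod 4])%N.
Proof.
(* Unlocked, the sum is a [foldr] over an explicit list, so all 2^11 words can be evaluated. *)
move=> s11; rewrite big_f4_plane unlock.
have: all (fun s =>
  foldr (fun p n => f4_word s p false * f4_word s p true + n)%N 0%N f4_plane
    == 3 * nth false s 0 + 2 * tof_cubic s %[mod 4])%N (bool_words 11).
  by vm_compute.
by move/allP => /(_ s); rewrite -s11 mem_bool_words => /(_ isT) /eqP.
Qed.

Lemma f4_word_inj (s : seq bool) : size s = 11%N ->
  (forall p b, f4_word s p b = false) -> s = nseq 11 false.
Proof.
move=> s11 s0; apply/eqP.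
have: all (fun s => all (fun p => ~~ f4_word s p false && ~~ f4_word s p true)
    f4_plane ==> (s == nseq 11 false)) (bool_words 11).
  by vm_compute.
move/allP => /(_ s); rewrite -{1}s11 mem_bool_words => /(_ isT) /implyP; apply.
by apply/allP => p _; rewrite !s0.
Qed.

(** Rows 5 to 10 come from x, y and 1, so the hypothesis amounts to [u1 + u2 = 0],
    [u1 x1 + u2 x2 = 0] and [u1 y1 + u2 y2 = 0] in F_4, which for distinct points forces both values
    to vanish. The proof evaluates all cases. *)
Lemma f4_two_points (p1 p2 : f4 * f4) (u1 u2 : f4) : p1 != p2 ->
  (forall r, (5 <= r < 11)%N ->
     f4_dot u1 (f4_row r p1) (+) f4_dot u2 (f4_row r p2) = false) ->
  u1 = (false, false) /\ u2 = (false, false).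
Proof.
move=> p12 dot0.
have /allP/(_ p1 (mem_f4_plane _)) :
  all (fun p1 => all (fun p2 => (p1 != p2) ==>
    (* [f4_plane] lists all of [f4 * f4], so it also enumerates the pairs [(u1, u2)]. *)
    all (fun u : f4 * f4 => all (fun r =>
        ~~ (f4_dot u.1 (f4_row r p1) (+) f4_dot u.2 (f4_row r p2))) (iota 5 6)
      ==> (u == (false, false, (false, false)))) f4_plane) f4_plane) f4_plane.
  by vm_compute.
move/allP/(_ p2 (mem_f4_plane _)); rewrite p12.
move=> /allP/(_ (u1, u2) (mem_f4_plane _)).
have -> /= : all (fun r =>
    ~~ (f4_dot u1 (f4_row r p1) (+) f4_dot u2 (f4_row r p2))) (iota 5 6).
  by apply/allP => r; rewrite mem_iota => /dot0 ->.
by move/eqP => [-> ->].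
Qed.

End BooleanF4.

(** * Transfer from the abstract field to the boolean model *)

Section FieldModel.
Variables (F : finFieldType) (w : F).
Hypotheses (cardF : #|F| = 4%N) (hw : w ^+ 2 = w + 1).

Let F2char : 2%N \in [pchar F].
Proof. exact: (@card_finPcharP _ 2 2 cardF isT). Qed.

Definition f4_val (p : f4) : F := w *+ p.1 + w ^+ 2 *+ p.2.

Let addww : w + w ^+ 2 = 1.
Proof. by rewrite hw addrA addrr_pchar2 // add0r. Qed.

Let w3 : w * w ^+ 2 = 1.
Proof. by rewrite hw mulrDr mulr1 -expr2 addrC. Qed.

Let w4 : w ^+ 2 * w ^+ 2 = w.
Proof. by rewrite {1}expr2 -mulrA w3 mulr1. Qed.

Lemma f4_valM p q : f4_val (f4_mul p q) = f4_val p * f4_val q.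
Proof.
have w3' : w ^+ 2 * w = 1 by rewrite mulrC w3.
by rewrite /f4_val; case: p q => [[] []] [[] []] /=;
  rewrite ?(mulr0n, mulr1n, addr0, add0r, mulr0, mul0r, addww, mulr1, mul1r);
  rewrite ?(w3, w3', w4).
Qed.

Lemma trF4_val p : trF4 (f4_val p) = (p.1 (+) p.2)%:R.
Proof.
rewrite /trF4 /f4_val; case: p => [[] []] /=;
  rewrite ?(mulr0n, mulr1n, addr0, add0r, addww) ?oner_eq0 //.
- by rewrite expr1n addrr_pchar2 ?eqxx.
- by rewrite [_ ^+ 2 ^+ 2]expr2 w4 addrC addww oner_eq0.
- by rewrite expr0n eqxx.
Qed.

(** In the self-dual basis an element [g] has coordinates [tr(g w)] and [tr(g w^2)], so the two
    block rows of [g] hold the coordinates of [g w] and of [g w^2]. *)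
Lemma bin_block_val p (r c : bool) : bin_block w (f4_val p) r c =
  (f4_coord c (f4_mul p (if r then (false, true) else (true, false))))%:R.
Proof.
have vw : f4_val (true, false) = w by rewrite /f4_val addr0.
have vw2 : f4_val (false, true) = w ^+ 2 by rewrite /f4_val add0r.
by case: r c => [] [] /=;
  [rewrite -[X in _ * X]vw -f4_valM | | | rewrite -vw2 -f4_valM];
  rewrite trF4_val; case: p => [[] []].
Qed.

Lemma f4_val_bij : bijective f4_val.
Proof.
apply: inj_card_bij; last by rewrite cardF card_prod card_bool.
have tr_inj (a b : bool) : a%:R = b%:R :> 'F_2 -> a = b by case: a b => [] [].
move=> p q pq.
(* The first block row determines the coordinates of [p w], and multiplication by [w] is injective
   on pairs. *)
have E c : f4_coord c (f4_mul p (true, false)) =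
           f4_coord c (f4_mul q (true, false)).
  by apply: tr_inj; rewrite -!(bin_block_val _ false) pq.
by move: (E false) (E true); case: p q {pq E} => [[] []] [[] []].
Qed.

Definition block_idx n (j : 'I_n) (b : bool) : 'I_(n.*2) :=
  if b then odd_idx j else even_idx j.

Lemma pair_block_idx n (j : 'I_n) b : pair_idx (block_idx j b) = j.
Proof. by apply/val_inj; case: b; rewrite /= ?doubleK ?uphalf_double. Qed.

Lemma odd_block_idx n (j : 'I_n) b : odd (block_idx j b) = b.
Proof. by case: b; rewrite /= odd_double. Qed.

Lemma tofH_block (col : 'I_16 -> F * F) (r : 'I_11) (j : 'I_16)
    (p : f4 * f4) b :
  col j = (f4_val p.1, f4_val p.2) ->
  tofH w col r (block_idx j b) = (f4_coord b (f4_row r p))%:R.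
Proof.
case: p => x y /= colj.
(* Deleting row 0 shifts [r] to [r + 1], which flips its parity. *)
have -> : tofH w col r (block_idx j b) =
    bin_block w (evalG col (@pair_idx 6 (lift ord0 r)) j) (~~ odd r) b.
  rewrite mxE [LHS]mxE; congr (bin_block w (evalG col _ _) _ _).
    exact: pair_block_idx.
  exact: odd_block_idx.
have -> : evalG col (@pair_idx 6 (lift ord0 r)) j = f4_val (nth (false, false)
    [:: f4_mul x y; f4_mul x x; f4_mul y y; x; y; (true, true)] r.+1./2).
  rewrite mxE colj.
  have -> : 1 = f4_val (true, true) :> F by rewrite /f4_val addww.
  rewrite !expr2 -!f4_valM.
  by case: r => [[|[|[|[|[|[|[|[|[|[|[|//]]]]]]]]]]]].
by rewrite bin_block_val if_neg.
Qed.

(** Absorbing the column order into [pt] frees the study of the code from [col], [F] and [w]. *)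
Lemma tofH_model (col : 'I_16 -> F * F) : bijective col ->
  exists2 pt : f4 * f4 -> 'I_16, bijective pt &
    forall (r : 'I_11) p b,
      tofH w col r (block_idx (pt p) b) = (f4_coord b (f4_row r p))%:R.
Proof.
case=> colV colK colVK; have [vV vK vVK] := f4_val_bij.
exists (fun p => colV (f4_val p.1, f4_val p.2)) => [|r p b]; last first.
  by apply: tofH_block; rewrite colVK.
exists (fun j => (vV (col j).1, vV (col j).2)) => [[x y]|j] /=.
  by rewrite colVK /= !vK.
by rewrite !vVK -surjective_pairing colK.
Qed.

End FieldModel.

(** * Sums over F_2, column pairs and sets of at most two points *)

Lemma F2_bool (u : 'F_2) : u = (u != 0)%:R.
Proof. by apply/val_inj; case: u => [[|[|//]] ?]. Qed.

Lemma bit_bool m (z : bits m) (i : 'I_m) (b : bool) :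
  z 0 i = b%:R -> bit z i = b.
Proof. by rewrite /bit => ->; case: b. Qed.

Lemma natF2_eq0 (b : bool) : (b%:R == 0 :> 'F_2) = ~~ b.
Proof. by case: b. Qed.

Lemma natF2_addb (a b : bool) : (a (+) b)%:R = a%:R + b%:R :> 'F_2.
Proof. by case: a b => [] []; apply/val_inj. Qed.

Lemma natF2_andb (a b : bool) : (a && b)%:R = a%:R * b%:R :> 'F_2.
Proof. by rewrite -mulnb natrM. Qed.

Lemma sum_F2_ord n (f : nat -> bool) :
  \sum_(r < n) (f r)%:R =
  (foldr addb false [seq f r | r <- iota 0 n])%:R :> 'F_2.
Proof.
rewrite -(big_mkord xpredT (fun r => (f r)%:R)) /index_iota subn0.
elim: (iota 0 n) => [|r s IHs]; first by rewrite big_nil.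
by rewrite big_cons IHs natF2_addb.
Qed.

Lemma big_block_idx (R : nmodType) n (g : 'I_(n.*2) -> R) :
  \sum_c g c = \sum_j (g (block_idx j false) + g (block_idx j true)).
Proof.
under [RHS]eq_bigr => j _ do
  rewrite addrC -(big_bool _ (fun b => g (block_idx j b))).
rewrite (pair_bigA _ (fun j b => g (block_idx j b))) /=.
rewrite (reindex (fun p : 'I_n * bool => block_idx p.1 p.2)) //=.
exists (fun c => (pair_idx c, odd c)) => [[j b] _|c _] /=; last first.
  by apply/val_inj; rewrite /block_idx; case: ifP => /= oc;
    rewrite -[RHS](odd_double_half c) oc.
by rewrite pair_block_idx odd_block_idx.
Qed.

(** The points [x] and [y] pad smaller sets, so that the two-point check also covers errors of
    weight 0 and 1. *)
Lemma card_le2_subset_pair (T : finType) (x y : T) (S : {set T}) : x != y ->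
  (#|S| <= 2)%N -> exists p q, p != q /\ S \subset [set p; q].
Proof.
move=> xy; rewrite leq_eqVlt => /orP[/cards2P|].
  by case=> p [q [pq ->]]; exists p, q.
rewrite ltnS leq_eqVlt => /orP[/cards1P[p ->]|].
  exists p, (if p == x then y else x); split; last exact: subsetUl.
  by case: ifP => [/eqP ->|->].
by rewrite ltnS leqn0 cards_eq0 => /eqP ->; exists x, y; rewrite sub0set.
Qed.

(** * Rank, CS phase and block distance of the code *)

Section Code.
Variables (H : 'M['F_2]_(5 + 6, 16.*2)) (pt : f4 * f4 -> 'I_16).
Hypotheses (pt_bij : bijective pt)
  (HE : forall (r : 'I_11) p b,
     H r (block_idx (pt p) b) = (f4_coord b (f4_row r p))%:R).

Definition bools_of (z : bits 11) : seq bool :=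
  [seq z 0 r != 0 | r <- enum 'I_11].

Lemma size_bools_of z : size (bools_of z) = 11%N.
Proof. by rewrite size_map size_enum_ord. Qed.

Lemma nth_bools_of (z : bits 11) (r : 'I_11) :
  z 0 r = (nth false (bools_of z) r)%:R.
Proof. by rewrite (nth_map r) ?size_enum_ord // nth_ord_enum -F2_bool. Qed.

Lemma word_model (z : bits 11) p b :
  (z *m H) 0 (block_idx (pt p) b) = (f4_word (bools_of z) p b)%:R.
Proof.
rewrite mxE /f4_word -(sum_F2_ord 11
  (fun r => nth false (bools_of z) r && f4_coord b (f4_row r p))).
by apply: eq_bigr => r _; rewrite HE natF2_andb nth_bools_of.
Qed.

Lemma code_rank : \rank H = 11%N.
Proof.
suff /eqP : row_free H by []; apply: inj_row_free => z zH0.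
have z0 := f4_word_inj (size_bools_of z); apply/rowP => r.
rewrite nth_bools_of z0 ?nth_nseq ?ltn_ord ?mxE // => p b.
have := word_model z p b; rewrite zH0 mxE => /esym/eqP.
by rewrite natF2_eq0 => /negbTE.
Qed.

Lemma code_CS (C : numClosedFieldType) : CS_op C H = mono_op (fun z =>
  'i ^+ (3 * nth false (bools_of z) 0) * (-1) ^+ tof_cubic (bools_of z)) id.
Proof.
rewrite /CS_op diag_opE; apply: eq_mono_op => z //.
rewrite -imagCX2 -exprD -[LHS]imagCX_mod4 -[RHS]imagCX_mod4; congr (_ ^+ _).
rewrite -(f4_word_phase (size_bools_of z)); congr (_ %% _)%N.
rewrite (reindex pt) /=; last exact: onW_bij.
apply: eq_bigr => p _; congr (muln _ _).
  exact: (bit_bool (word_model z p false)).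
exact: (bit_bool (word_model z p true)).
Qed.

Definition block_val (e : 'rV['F_2]_(16.*2)) (p : f4 * f4) : f4 :=
  (e 0 (block_idx (pt p) false) != 0, e 0 (block_idx (pt p) true) != 0).

Lemma dot_model (e : 'rV_(16.*2)) (r : 'I_11) :
  \sum_c e 0 c * H r c = \sum_p (f4_dot (block_val e p) (f4_row r p))%:R.
Proof.
rewrite big_block_idx (reindex pt) /=; last exact: onW_bij.
apply: eq_bigr => p _; rewrite /f4_dot natF2_addb !natF2_andb -!F2_bool.
by rewrite (HE r p false) (HE r p true).
Qed.

Lemma pair_weight_model e :
  pair_weight e = #|[set p | block_val e p != (false, false)]|.
Proof.
have [ptV ptK ptVK] := pt_bij.
rewrite /pair_weight -(card_imset _ (bij_inj pt_bij)); apply: eq_card => j.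
rewrite inE -[j]ptVK mem_imset ?inE; last exact: bij_inj.
rewrite /block_val xpair_eqE negb_and.
by do 2![case: (_ != 0)].
Qed.

(** If the support lies in two points, the stabilizer equations force the error to vanish, so it is
    orthogonal to every logical row. *)
Lemma code_distance_ge e :
  logical_Z_error (H : 'M_(5 + 6, 16.*2)) e -> (3 <= pair_weight e)%N.
Proof.
case=> stab [ i ]; apply: contraNT.
rewrite -ltnNge ltnS pair_weight_model => le2.
set S := [set p | _] in le2.
have [p1 [p2 [p12 S12]]] := @card_le2_subset_pair _
  (false, false, (false, false)) (false, false, (false, true)) S isT le2.
have two (r : 'I_11) : \sum_c e 0 c * H r c =
    (f4_dot (block_val e p1) (f4_row r p1) (+)
     f4_dot (block_val e p2) (f4_row r p2))%:R.
  rewrite dot_model (bigD1 p1) // (bigD1 p2) /=; last by rewrite eq_sym.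
  rewrite big1 ?addr0 ?natF2_addb // => p /andP[np1 np2].
  have : p \notin S.
    by apply: contra np2 => /(subsetP S12); rewrite !inE (negbTE np1).
  by rewrite inE negbK => /eqP ->; rewrite /f4_dot.
have [|e1 e2] :=
  f4_two_points (u1 := block_val e p1) (u2 := block_val e p2) p12.
  move=> r /andP[r5 r11]; have r6 : (r - 5 < 6)%N by rewrite ltn_subLR.
  have rE : rshift 5 (Ordinal r6) = Ordinal r11 :> 'I_11.
    by apply/val_inj; rewrite /= subnKC.
  have := stab (Ordinal r6); under eq_bigr do rewrite mxE rE.
  by rewrite two => /eqP; rewrite natF2_eq0 => /negbTE.
under eq_bigr do rewrite mxE.
by rewrite two e1 e2 eqxx.
Qed.

(* [w^2], [w], [1] at the points [(0, 0)], [(1, 0)], [(w, 0)]: the sums of [E]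
   and of [E x] vanish, the sum of [E x^2] is [w + w^2 = 1]. *)
Definition line_error (p : f4 * f4) : f4 :=
  if p == (false, false, (false, false)) then (false, true) else
  if p == (true, true, (false, false)) then (true, false) else
  if p == (true, false, (false, false)) then (true, true) else (false, false).

Lemma code_distance_le :
  exists e, logical_Z_error (H : 'M_(5 + 6, 16.*2)) e /\ pair_weight e = 3.
Proof.
have [ptV ptK _] := pt_bij.
pose e : 'rV['F_2]_(16.*2) :=
  \row_c (f4_coord (odd c) (line_error (ptV (pair_idx c))))%:R.
have ve p : block_val e p = line_error p.
  rewrite /block_val !mxE !pair_block_idx !odd_block_idx ptK !natF2_eq0 !negbK.
  by rewrite -surjective_pairing.
move: e ve => e ve.
have dotE (r : 'I_11) : \sum_c e 0 c * H r c =
    (foldr addb false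
      [seq f4_dot (line_error p) (f4_row r p) | p <- f4_plane])%:R.
  rewrite dot_model big_f4_plane; elim: f4_plane => [|p s IHs].
    by rewrite big_nil.
  by rewrite big_cons IHs ve /= natF2_addb.
exists e; split; last first.
  rewrite pair_weight_model -sum1dep_card big_f4_plane sum1_count.
  rewrite (eq_count (a2 := fun p => line_error p != (false, false))) // => p.
  by rewrite ve.
split=> [i|].
  under eq_bigr do rewrite mxE.
  rewrite dotE; case: i => [[|[|[|[|[|[|//]]]]]] ?]; by vm_compute.
(* Row 1 lists the coordinates of [w x^2]; as the sum of [E x^2] is 1, the product is
   [tr(w) = 1]. *)
exists (Ordinal (isT : (1 < 5)%N)); under eq_bigr do rewrite mxE.
by rewrite dotE; vm_compute.
Qed.

End Code.

(** * Clifford equivalence of the logical phase with TOF# *)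

Section TofClifford.
Variable C : numClosedFieldType.

Definition F2_mx (m n : nat) (M : seq (seq nat)) : 'M['F_2]_(m, n) :=
  \matrix_(i, j) (nth 0%N (nth [::] M i) j)%:R.

(* [z |-> (z1, z3 + z4, z0, z2, z3)], under which TOF# becomes
   [(-1) ^ (z0 (z1 z3 + z1 z4 + z2 z3))]. *)
Definition tof_basis : 'M['F_2]_5 := F2_mx 5 5
  [:: [:: 0; 0; 1; 0; 0]; [:: 1; 0; 0; 0; 0]; [:: 0; 0; 0; 1; 0];
      [:: 0; 1; 0; 0; 1]; [:: 0; 1; 0; 0; 0]].

Lemma tof_basis_unit : tof_basis \in unitmx.
Proof.
(* Matrix of the inverse substitution [y |-> (y2, y0, y3, y4, y1 + y4)]. *)
pose B : 'M['F_2]_5 := F2_mx 5 5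
  [:: [:: 0; 1; 0; 0; 0]; [:: 0; 0; 0; 0; 1]; [:: 1; 0; 0; 0; 0];
      [:: 0; 0; 1; 0; 0]; [:: 0; 0; 0; 1; 1]].
suff AB : tof_basis *m B = 1%:M by have [uA _] := mulmx1_unit AB.
apply/matrixP => i j; rewrite mxE !big_ord_recl big_ord0 !mxE.
by case: i j => [[|[|[|[|[|//]]]]] ?] [[|[|[|[|[|//]]]]] ?]; apply/eqP.
Qed.

Definition logical_phase (z : bits 5) : nat :=
  (bit z (inord 0) * (bit z (inord 1) * bit z (inord 3) +
   bit z (inord 1) * bit z (inord 4) + bit z (inord 2) * bit z (inord 3)))%N.

Definition logical_tof : qop C 5 :=
  mono_op (fun z => (-1) ^+ logical_phase z) id.

(** With [y = z tof_basis], the sum [y0 y1 y2 + y2 y3 y4] is [z0 z1 (z3 + z4) + z0 z2 z3] modulo 2;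
    the rightmost factor acts first. *)
Lemma logical_tofE :
  logical_tof =
  linear_op C (invmx tof_basis) *m TOFsharp C *m linear_op C tof_basis.
Proof.
rewrite /TOFsharp diag_opE !mono_opM; apply: eq_mono_op => z /=; last first.
  by rewrite mulmxK // tof_basis_unit.
rewrite mul1r mulr1.
have yE (k : 'I_5) : (z *m tof_basis) 0 k =
  [:: z 0 (inord 1); z 0 (inord 3) + z 0 (inord 4); z 0 (inord 0);
      z 0 (inord 2); z 0 (inord 3)]`_k.
  rewrite mxE.
  transitivity (\sum_(j < 5) z 0 (inord j) * tof_basis (inord j) k).
    by apply: eq_bigr => j _; rewrite inord_val.
  rewrite -(big_mkord xpredT (fun i => z 0 (inord i) * tof_basis (inord i) k)).
  rewrite /index_iota /= !big_cons big_nil !mxE !inordK //.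
  by case: k => [[|[|[|[|[|//]]]]] ?] /=;
    rewrite ?(mulr0, mulr1, add0r, addr0).
rewrite /logical_phase /bit !yE !inordK //=.
(* The bit [y1] is [z3 + z4] already reduced modulo 2, so the two exponents agree only in parity. *)
rewrite -[LHS]signr_odd -[RHS]signr_odd; congr (_ ^+ (nat_of_bool _)).
move: (z 0 _) (z 0 _) (z 0 _) (z 0 _) (z 0 _).
by do 5![case=> [[|[|//]] ?]].
Qed.

Lemma logical_tof_equiv : clifford_equiv logical_tof (TOFsharp C).
Proof.
exists (linear_op C (invmx tof_basis)), (linear_op C tof_basis).
split; last exact: logical_tofE.
  by apply: linear_op_clifford; rewrite unitmx_inv tof_basis_unit.
exact: linear_op_clifford tof_basis_unit.
Qed.

Lemma logical_tof_unitary : logical_tof \is unitarymx.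
Proof.
apply: (@mono_op_unitary _ _ _ id id) => // z.
by rewrite rmorph_sign -exprMn mulrNN mulr1 expr1n.
Qed.

End TofClifford.

Theorem mainTheorem16 (R : realType) (F : finFieldType) (cardF : #|F| = 4%N)
    (w : F) (hw : w ^+ 2 = w + 1)
    (col : 'I_16 -> F * F) (col_bij : bijective col) :
  [/\ \rank (tofH w col) = 11%N,
      exists (Cl : qop R[i] (5 + 6)) (V : qop R[i] 5),
        [/\ is_clifford Cl, is_diag_mx Cl, V \is unitarymx,
            clifford_equiv V (TOFsharp R[i]) &
            CS_op R[i] (tofH w col) = Cl *m op_tensor V (1%:M : qop R[i] 6)] &
      is_block_Z_distance (tofH w col) 3].
Proof.
have [pt pt_bij ptE] := tofH_model cardF hw col_bij.
split; first exact: code_rank ptE.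
  (* The constant 3 is the coefficient of [z_0] in the phase; the gate is the inverse phase gate on
     logical qubit 0. *)
  exists (phase_op R[i] 3 (ord0 : 'I_(5 + 6))), (logical_tof R[i]); split.
  - exact: phase_op_clifford.
  - exact: mono_op_diag.
  - exact: logical_tof_unitary.
  - exact: logical_tof_equiv.
  rewrite (code_CS pt_bij ptE) op_tensor_diag1 mono_opM.
  apply: eq_mono_op => z //=.
  have b r : bit z r = nth false (bools_of z) r := bit_bool (nth_bools_of z r).
  have bl k : bit (lsubmx z) k = nth false (bools_of z) k.
    by rewrite /bit mxE; exact: b.
  by rewrite b /logical_phase /tof_cubic !bl !inordK.
split; first exact: code_distance_le pt_bij ptE.
by move=> e err; apply: (code_distance_ge pt_bij ptE err).
Qed.
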